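(* Let $B$ be an oriented graph that admits a homomorphism $B \to \vec K_2$. Then the underlying undirected graph $\overline{B}$ (with the bipartition induced by this homomorphism) has the asymmetric Sidorenko property if and only if $B$ has the directed Sidorenko property.
   Context: All graphs are finite with non-empty vertex set. An oriented graph is a directed graph obtained from a simple undirected graph by orienting each edge (so there are no loops and at most one of $(x,y),(y,x)$ is an edge). For a graph or oriented graph $G$, $V(G)$, $E(G)$ are its vertex and edge sets, $v(G)=|V(G)|$, $e(G)=|E(G)|$. $\vec K_2$ is the oriented graph with two vertices and a single directed edge. $\overline{B}$ denotes the undirected graph obtained from the oriented graph $B$ by forgetting the directions of all edges. A homomorphism of oriented graphs $f:V(B)\to V(G)$ is a map such that $(f(x),f(y))\in E(G)$ whenever $(x,y)\in E(B)$. The homomorphism density $t(B,G)$ is the number of homomorphisms from $B$ to $G$ divided by $v(G)^{v(B)}$; in particular $t(\vec K_2,G)=e(G)/v(G)^2$. An oriented graph $B$ has the directed Sidorenko property if for every oriented graph $G$ one has $t(B,G)\ge t(\vec K_2,G)^{e(B)}$. A bipartite undirected graph always comes with a fixed ordered bipartition of its vertex set. If $A$ is bipartite with parts $A_1\sqcup A_2$ and $H$ is bipartite with non-empty parts $U_1\sqcup U_2$, then $t_{\mathrm{bip}}(A,H)$ is the fraction of maps $f:V(A)\to V(H)$ with $f(A_1)\subset U_1$ and $f(A_2)\subset U_2$ that are homomorphisms (i.e. send edges to edges). In particular $t_{\mathrm{bip}}(K_2,H)=|E(H)|/(|U_1||U_2|)$. The graph $A$ has the asymmetric Sidorenko property if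 $t_{\mathrm{bip}}(A,H)\ge t_{\mathrm{bip}}(K_2,H)^{e(A)}$ for all bipartite undirected graphs $H$. If $B$ has a homomorphism to $\vec K_2$, then $\overline{B}$ is regarded as a bipartite graph whose first part is the set of vertices mapped to the tail of the edge of $\vec K_2$ and whose second part is the set of vertices mapped to the head, so that all edges of $B$ are directed from the first part to the second. *)

(* Defs.v *)
From mathcomp Require Import all_boot all_order all_algebra.

Set Implicit Arguments.
Unset Strict Implicit.
Unset Printing Implicit Defensive.

Import Order.TTheory GRing.Theory Num.Theory.
Local Open Scope ring_scope.

(* [oedge_asym] applied with x = y also excludes loops. *)
Record ograph := OGraph {
  overtex :> finType;
  oedge : rel overtex;
  ograph_nonempty : (0 < #|overtex|)%N;
  oedge_asym : forall x y, oedge x y -> ~~ oedge y x }.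

Definition oedges (G : ograph) : {set G * G} :=
  [set p | oedge p.1 p.2].

Definition is_ohom (B G : ograph) (f : B -> G) : bool :=
  [forall x, forall y, oedge x y ==> oedge (f x) (f y)].

Definition t (B G : ograph) : rat :=
  #|[set f : {ffun B -> G} | is_ohom f]|%:R / (#|G| ^ #|B|)%:R.

Lemma dK2_nonempty : (0 < #|{: bool}|)%N.
Proof. by rewrite card_bool. Qed.

Lemma dK2_asym (x y : bool) : ~~ x && y -> ~~ (~~ y && x).
Proof. by case: x y => [] []. Qed.

(* The single edge goes from the tail [false] to the head [true]. *)
Definition dK2 : ograph :=
  @OGraph bool (fun x y => ~~ x && y) dK2_nonempty dK2_asym.

Definition dK2_tail : dK2 := false.

Definition directed_Sidorenko (B : ograph) : Prop :=
  forall G : ograph, t dK2 G ^+ #|oedges B| <= t B G.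

Record sgraph := SGraph {
  svertex :> finType;
  sedge : rel svertex;
  sgraph_nonempty : (0 < #|svertex|)%N;
  sedge_sym : symmetric sedge;
  sedge_irr : irreflexive sedge }.

(* Unordered edges: each edge {x, y} is counted once. *)
Definition sedges (G : sgraph) : {set {set G}} :=
  [set [set p.1; p.2] | p : G * G & sedge p.1 p.2].

Definition is_shom (A H : sgraph) (f : A -> H) : bool :=
  [forall x, forall y, sedge x y ==> sedge (f x) (f y)].

(* The ordered bipartition is (part1, ~: part1); either part may be empty. *)
Record bigraph := BiGraph {
  bi_graph :> sgraph;
  part1 : {set bi_graph};
  bi_edge : forall x y : bi_graph,
    sedge x y -> (x \in part1) != (y \in part1) }.

Definition part2 (A : bigraph) : {set A} := ~: part1 A.

Definition part_maps (A H : bigraph) : {set {ffun A -> H}} :=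
  [set f : {ffun A -> H} |
    (f @: part1 A \subset part1 H) && (f @: part2 A \subset part2 H)].

Definition t_bip (A H : bigraph) : rat :=
  #|[set f in part_maps A H | is_shom f]|%:R / #|part_maps A H|%:R.

Lemma K2_sym : symmetric (fun x y : bool => x != y).
Proof. by move=> x y; rewrite eq_sym. Qed.

Lemma K2_irr : irreflexive (fun x y : bool => x != y).
Proof. by move=> x; rewrite eqxx. Qed.

Definition K2_graph : sgraph :=
  @SGraph bool (fun x y => x != y) dK2_nonempty K2_sym K2_irr.

Lemma K2_bi_edge (x y : K2_graph) :
  sedge x y -> (x \in [set false]) != (y \in [set false]).
Proof. by rewrite !inE; case: x y => [] []. Qed.

Definition K2 : bigraph := BiGraph K2_bi_edge.

Definition asymmetric_Sidorenko (A : bigraph) : Prop :=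
  forall H : bigraph, part1 H != set0 -> part2 H != set0 ->
    t_bip K2 H ^+ #|sedges A| <= t_bip A H.

Section Underlying.

Variable B : ograph.

Let uedge (x y : B) : bool := oedge x y || oedge y x.

Lemma underlying_sym : symmetric uedge.
Proof. by move=> x y; rewrite /uedge orbC. Qed.

Lemma underlying_irr : irreflexive uedge.
Proof.
move=> x; rewrite /uedge orbb; apply/negP => xx.
by have := oedge_asym xx; rewrite xx.
Qed.

Definition underlying : sgraph :=
  SGraph (ograph_nonempty B) underlying_sym underlying_irr.

Variable h : B -> dK2.
Hypothesis hom_h : is_ohom h.

Lemma underlying_bi_edge (x y : underlying) :
  sedge x y ->
  (x \in [set z | h z == dK2_tail]) != (y \in [set z | h z == dK2_tail]).
Proof.
have hE u v : oedge u v -> ~~ h u && h v.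
  by move=> uv; have /forallP/(_ u)/forallP/(_ v)/implyP/(_ uv) := hom_h.
by rewrite !inE => /orP[] /hE /andP[/negbTE -> ->].
Qed.

Definition underlying_bip : bigraph := BiGraph underlying_bi_edge.

End Underlying.

(* Main.v *)
(* Applied to the bipartite double cover of an oriented graph [G], the asymmetric
   inequality is literally the directed one for [G]. Conversely, a bipartite graph
   on U1, U2 is the same, for densities, as a relation [r] on U1 * U2 (which blows
   up both parts to equal size). Doubling the vertex set of [r] gives an oriented
   graph, at the cost of a factor 1/4 in the edge density; applying the directed
   property to the doubles of all tensor powers of [r] removes this factor. *)

Require Import Defs.
From mathcomp Require Import all_boot all_order all_algebra.
From mathcomp Require Import ring lra.

Set Implicit Arguments.
Unset Strict Implicit.
Unset Printing Implicit Defensive.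

Import Order.TTheory GRing.Theory Num.Theory.
Local Open Scope ring_scope.

(** * Absorbing a constant factor by taking powers *)

Lemma le_of_le_exp (R : archiRealFieldType) (a b C : R) :
  0 <= a -> 0 <= b -> (forall k, b ^+ k <= C * a ^+ k) -> b <= a.
Proof.
move=> a0 b0 H; rewrite leNgt; apply/negP => ab.
have C0 : 1 <= C by have := H 0%N; rewrite !expr0 mulr1.
have [az|an0] := eqVneq a 0.
  by have := H 1%N; rewrite !expr1 az mulr0 leNgt -az ab.
have ap : 0 < a by rewrite lt_def an0.
pose d := (b - a) / a.
have dp : 0 < d by rewrite divr_gt0 // subr_gt0.
have bE : b = (1 + d) * a by rewrite /d; field.
(* Bernoulli's inequality: if [a < b], the powers of [b / a = 1 + d] grow without bound. *)
have bern k : 1 + k%:R * d <= (1 + d) ^+ k.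
  elim: k => [|k IHk]; first by rewrite expr0 mul0r addr0.
  rewrite exprS; have := ler_wpM2l (ltW (addr_gt0 ltr01 dp)) IHk.
  apply: le_trans.
  have -> : (1 + d) * (1 + k%:R * d) = 1 + k.+1%:R * d + k%:R * d ^+ 2.
    by rewrite -natr1; ring.
  by rewrite lerDl mulr_ge0 ?sqr_ge0.
(* A [k] above [C / d] gives [1 + k%:R * d > C], against [(1 + d) ^+ k <= C]. *)
have /archi_boundP : 0 <= C / d by rewrite divr_ge0 ?ltW // (lt_le_trans ltr01).
set k := Num.bound _; rewrite ltr_pdivrMr // => kC.
have := H k; rewrite bE exprMn ler_pM2r ?exprn_gt0 // => Hk.
have := bern k; lra.
Qed.

(** * Homomorphism densities of arbitrary relations and their tensor powers *)

Definition rel_homs (S T : finType) (e : rel S) (r : rel T) : {set {ffun S -> T}} :=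
  [set f : {ffun S -> T} | [forall x, forall y, e x y ==> r (f x) (f y)]].

Definition rel_density (S T : finType) (e : rel S) (r : rel T) : rat :=
  #|rel_homs e r|%:R / (#|T| ^ #|S|)%:R.

Lemma rel_homsP (S T : finType) (e : rel S) (r : rel T) (f : {ffun S -> T}) :
  reflect (forall x y, e x y -> r (f x) (f y)) (f \in rel_homs e r).
Proof.
rewrite inE; apply: (iffP forallP) => H x => [y|].
  by move/forallP/(_ y)/implyP: (H x).
by apply/forallP => y; apply/implyP/H.
Qed.

Lemma eq_rel_density (S T : finType) (e e' : rel S) (r : rel T) :
  e =2 e' -> rel_density e r = rel_density e' r.
Proof.
move=> ee'; rewrite /rel_density; congr (#|pred_of_set _|%:R / _).
by apply/setP => f; apply/rel_homsP/rel_homsP => H x y exy; apply: H;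
  rewrite ?ee' // -ee'.
Qed.

Lemma rel_density_ge0 (S T : finType) (e : rel S) (r : rel T) :
  0 <= rel_density e r.
Proof. by rewrite divr_ge0 ?ler0n. Qed.

Definition pow_rel (T : finType) (k : nat) (r : rel T) : rel {ffun 'I_k -> T} :=
  fun a b => [forall i, r (a i) (b i)].

(** Exchanging the two arguments turns a homomorphism into the tensor power into a [k]-tuple of
    homomorphisms into [r]. *)
Lemma card_rel_homs_pow (S T : finType) (k : nat) (e : rel S) (r : rel T) :
  #|rel_homs e (@pow_rel T k r)| = (#|rel_homs e r| ^ k)%N.
Proof.
have -> : (#|rel_homs e r| ^ k = #|rel_homs e r| ^ #|'I_k|)%N by rewrite card_ord.
rewrite -card_ffun_on.
pose swap (A B : finType) (f : {ffun A -> {ffun B -> T}}) :=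
  [ffun b => [ffun a => f a b]].
have swapK A B : cancel (@swap A B) (@swap B A).
  by move=> f; apply/ffunP => a; apply/ffunP => b; rewrite !ffunE.
rewrite -(card_imset _ (can_inj (@swapK S 'I_k))).
apply: eq_card => g; apply/imsetP/ffun_onP.
  case=> f /rel_homsP fP -> i; apply/rel_homsP => x y /fP /forallP /(_ i).
  by rewrite !ffunE.
move=> gP; exists (swap _ _ g); last by rewrite swapK.
apply/rel_homsP => x y exy; apply/forallP => i; rewrite !ffunE.
by move/rel_homsP: (gP i); apply.
Qed.

Lemma rel_density_pow (S T : finType) (k : nat) (e : rel S) (r : rel T) :
  rel_density e (@pow_rel T k r) = rel_density e r ^+ k.
Proof.
rewrite /rel_density card_rel_homs_pow card_ffun card_ord.
by rewrite -expnM mulnC expnM !natrX expr_div_n.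
Qed.

(** * Doubling a relation into an oriented graph *)

Definition bip_double (T : finType) (r : rel T) : rel (T * bool) :=
  fun a b => [&& ~~ a.2, b.2 & r a.1 b.1].

(** All edges run from the [false] copy to the [true] copy, so [r] itself may have loops or opposite
    pairs. *)
Lemma bip_double_asym (T : finType) (r : rel T) (a b : T * bool) :
  bip_double r a b -> ~~ bip_double r b a.
Proof. by rewrite /bip_double => /and3P[_ -> _]. Qed.

(** The first coordinate of a homomorphism into the double is a homomorphism into [r]; the second
    leaves at most [2 ^ #|S|] choices, which the larger denominator offsets. *)
Lemma rel_density_bip_double_le (S T : finType) (e : rel S) (r : rel T) :
  (0 < #|T|)%N -> rel_density e (bip_double r) <= rel_density e r.
Proof.
move=> T0; rewrite /rel_density card_prod card_bool expnMn natrM invfM mulrA.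
rewrite mulrAC ler_pM2r ?invr_gt0 ?ltr0n ?expn_gt0 ?T0 //.
rewrite ler_pdivrMr ?ltr0n ?expn_gt0 // -natrM ler_nat.
pose split (f : {ffun S -> T * bool}) : {ffun S -> T} * {ffun S -> bool} :=
  ([ffun x => (f x).1], [ffun x => (f x).2]).
have split_inj : injective split.
  move=> f g [/ffunP f1 /ffunP f2]; apply/ffunP => x.
  by move: (f1 x) (f2 x); rewrite !ffunE; case: (f x) (g x) => ? ? [? ?] /= -> ->.
rewrite -(card_imset _ split_inj) -card_bool -(card_ffun S bool) -cardsT -cardsX.
apply/subset_leq_card/subsetP => _ /imsetP[f /rel_homsP fP ->].
rewrite in_setX in_setT andbT; apply/rel_homsP => x y /fP /and3P[_ _].
by rewrite !ffunE.
Qed.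

(** Tagging the tail with [false] and the head with [true] lifts each edge of [r]; the factor [4] is
    the growth of the number of vertex pairs. *)
Lemma rel_density_dK2_bip_double_ge (T : finType) (r : rel T) :
  (0 < #|T|)%N ->
  rel_density (@oedge dK2) r / 4 <= rel_density (@oedge dK2) (bip_double r).
Proof.
move=> T0; rewrite /rel_density card_prod !card_bool expnMn natrM invfM mulrA.
rewrite ler_pM2r ?invr_gt0 ?ltr0n //.
rewrite ler_pM2r ?invr_gt0 ?ltr0n ?expn_gt0 ?T0 // ler_nat.
pose tag (f : {ffun dK2 -> T}) : {ffun dK2 -> T * bool} := [ffun x => (f x, x)].
have tag_inj : injective tag.
  by move=> f g /ffunP fg; apply/ffunP => x; move: (fg x); rewrite !ffunE => -[].
rewrite -(card_imset _ tag_inj).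
apply/subset_leq_card/subsetP => _ /imsetP[f /rel_homsP fP ->].
apply/rel_homsP => x y exy; rewrite !ffunE /bip_double /= fP // andbT.
by move: exy; rewrite /=.
Qed.

Lemma directed_Sidorenko_rel (B : ograph) (T : finType) (r : rel T) :
  directed_Sidorenko B -> (0 < #|T|)%N ->
  rel_density (@oedge dK2) r ^+ #|oedges B| <= rel_density (@oedge B) r.
Proof.
move=> sidB T0.
(* Doubling loses a factor [4] per edge of [B], whatever the power [k]. *)
apply: (@le_of_le_exp _ _ _ (4 ^+ #|oedges B|)) => [||k];
  rewrite ?exprn_ge0 ?rel_density_ge0 //.
have Tk0 : (0 < #|{: {ffun 'I_k -> T}}|)%N.
  by rewrite card_ffun card_ord expn_gt0 T0.
have Tk20 : (0 < #|{: {ffun 'I_k -> T} * bool}|)%N.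
  by rewrite card_prod card_bool muln_gt0 Tk0.
pose G := OGraph Tk20 (@bip_double_asym _ (@pow_rel T k r)).
have lo := rel_density_dK2_bip_double_ge (@pow_rel T k r) Tk0.
have up := rel_density_bip_double_le (@oedge B) (@pow_rel T k r) Tk0.
(* [t] unfolds to [rel_density] of the edge relations, so the hypothesis applies by conversion. *)
have mid : rel_density (@oedge dK2) (@oedge G) ^+ #|oedges B|
           <= rel_density (@oedge B) (@oedge G) := sidB G.
rewrite !rel_density_pow in lo up.
have := le_trans (lerXn2r #|oedges B| _ _ lo) (le_trans mid up).
rewrite !nnegrE rel_density_ge0 divr_ge0 ?exprn_ge0 ?rel_density_ge0 //.
move=> /(_ isT isT); rewrite expr_div_n ler_pdivrMr ?exprn_gt0 //.
by rewrite -!exprM mulnC [leRHS]mulrC.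
Qed.

(** * Bipartite densities as relation densities *)

Definition arc (A : bigraph) : rel A :=
  fun x y => (x \in part1 A) && sedge x y.

(** Group the maps [f] by their composite [g]: the lifts of a given [g] are chosen independently at
    each [x], in [c x] ways. *)
Lemma card_uniform_fibres (S T U : finType) (p : S -> T -> U) (D : S -> {set U})
    (c : S -> nat) (P : pred {ffun S -> U}) :
  (forall x t, p x t \in D x) ->
  (forall x u, u \in D x -> #|[set t | p x t == u]| = c x) ->
  #|[set f : {ffun S -> T} | P [ffun x => p x (f x)]]|
  = (#|[set g in family D | P g]| * \prod_x c x)%N.
Proof.
move=> pD pc; pose phi (f : {ffun S -> T}) := [ffun x => p x (f x)].
rewrite -sum1_card (partition_big phi (mem [set g in family D | P g])) /=.
  rewrite -sum_nat_const; apply: eq_bigr => g; rewrite inE => /andP[/familyP gD Pg].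
  rewrite sum1_card -(eq_bigr _ (fun x _ => pc x _ (gD x))).
  transitivity #|family (fun x => [set t | p x t == g x])|; last first.
    by rewrite card_family foldrE big_image.
  apply: eq_card => f; rewrite !inE; apply/andP/familyP => [[_ /eqP <-] x|fg].
    by rewrite inE ffunE.
  have fE : phi f = g.
    by apply/ffunP => x; move: (fg x); rewrite inE ffunE => /eqP.
  by rewrite inE -/(phi f) fE.
move=> f; rewrite !inE => ->; rewrite andbT.
by apply/familyP => x; rewrite ffunE pD.
Qed.

(* A part-preserving map [A -> H] only reads one of the two coordinates
   [p1 (f x)], [p2 (f x)] at each vertex, so uniform projections [p1] and [p2]
   turn bipartite densities into densities of a relation on a single set. *)
Lemma t_bip_rel_density (A H : bigraph) (T : finType) (p1 p2 : T -> H)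
    (c1 c2 : nat) :
  (0 < c1)%N -> (0 < c2)%N ->
  (forall t, p1 t \in part1 H) -> (forall t, p2 t \in part2 H) ->
  (forall u, u \in part1 H -> #|[set t | p1 t == u]| = c1) ->
  (forall u, u \in part2 H -> #|[set t | p2 t == u]| = c2) ->
  t_bip A H = rel_density (@arc A) (fun a b => sedge (p1 a) (p2 b)).
Proof.
move=> c1_gt0 c2_gt0 p1H p2H p1c p2c.
pose p (x : A) t := if x \in part1 A then p1 t else p2 t.
pose D (x : A) := if x \in part1 A then part1 H else part2 H.
pose c (x : A) := if x \in part1 A then c1 else c2.
have pD x t : p x t \in D x by rewrite /p /D; case: ifP.
have pc x u : u \in D x -> #|[set t | p x t == u]| = c x.
  rewrite /p /D /c; case: ifP => _; [exact: p1c|exact: p2c].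
have pmE : part_maps A H =i family D.
  move=> g; rewrite inE; apply/andP/familyP => [[/subsetP g1 /subsetP g2] x|gD].
    rewrite /D; case: ifP => xA; first by rewrite g1 // imset_f.
    by rewrite g2 // imset_f // inE xA.
  split; apply/subsetP => _ /imsetP[x xA ->]; have := gD x; rewrite /D.
    by rewrite xA.
  by move: xA; rewrite inE => /negbTE ->.
(* Denominator and numerator pick up the same factor [\prod_x c x], which cancels at the end. *)
have all_maps : (#|T| ^ #|A|)%N = (#|part_maps A H| * \prod_x c x)%N.
  rewrite -card_ffun -cardsT.
  have := card_uniform_fibres predT pD pc.
  rewrite (_ : [set g in family D | predT g] = part_maps A H).
    by move=> <-; apply: eq_card => f; rewrite !inE.
  by apply/setP => g; rewrite inE andbT pmE.
have homs : #|rel_homs (@arc A) (fun a b => sedge (p1 a) (p2 b))| =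
    (#|[set f in part_maps A H | is_shom f]| * \prod_x c x)%N.
  rewrite (_ : [set f in part_maps A H | is_shom f] =
               [set g in family D | is_shom g]); last first.
    by apply/setP => g; rewrite [LHS]in_set [RHS]in_set pmE.
  rewrite -(card_uniform_fibres (fun g => is_shom g) pD pc).
  apply: eq_card => f; rewrite [RHS]inE; apply/rel_homsP/idP => fP.
    apply/forallP => x; apply/forallP => y; apply/implyP => xy.
    have := bi_edge xy; rewrite !ffunE /p.
    case: ifP => xA; case: ifP => yA // _; first by rewrite fP // /arc xA.
    by rewrite sedge_sym fP // /arc yA sedge_sym.
  move=> x y /andP[xA xy].
  move/forallP/(_ x)/forallP/(_ y)/implyP/(_ xy): fP.
  rewrite !ffunE /p xA; have := bi_edge xy.
  by rewrite xA; case: ifP.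
have c_neq0 : (\prod_x c x)%:R != 0 :> rat.
  by rewrite pnatr_eq0 -lt0n; apply: prodn_gt0 => x; rewrite /c; case: ifP.
by rewrite /t_bip /rel_density homs all_maps !natrM invfM mulrACA divff // mulr1.
Qed.

Lemma arc_K2 : @arc K2 =2 @oedge dK2.
Proof. by case=> [] []; rewrite /arc !inE. Qed.

(** Since [h] sends every tail to [false] and every head to [true], orienting the underlying edges
    out of the first part restores their directions in [B]. *)
Lemma arc_underlying (B : ograph) (h : B -> dK2) (hom_h : is_ohom h) :
  @arc (underlying_bip hom_h) =2 @oedge B.
Proof.
have hE u v : oedge u v -> ~~ h u && h v.
  by move=> uv; move/forallP/(_ u)/forallP/(_ v)/implyP/(_ uv): hom_h.
move=> x y; rewrite /arc inE /=.
apply/andP/idP => [[/eqP hx /orP[//|/hE]]|xy].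
  by rewrite hx andbF.
by rewrite xy /dK2_tail; case/andP: (hE _ _ xy) => /negbTE ->.
Qed.

Lemma card_sedges_underlying (B : ograph) : #|sedges (underlying B)| = #|oedges B|.
Proof.
pose ends (p : B * B) := [set p.1; p.2].
have ends_inj : {in oedges B &, injective ends}.
  (* Apart from equal pairs, equal end sets would force a loop or two opposite edges, both excluded
     by [oedge_asym]. *)
  move=> [a b] [a' b']; rewrite !inE /= => ab ab' /setP E.
  have := E a; rewrite !inE eqxx => /esym/orP[]/eqP aE; subst a;
    have := E b; rewrite !inE eqxx orbT => /esym/orP[]/eqP bE; subst b => //.
  - by have := oedge_asym ab; rewrite ab.
  - by have := oedge_asym ab; rewrite ab'.
  - by have := oedge_asym ab; rewrite ab.
rewrite -(card_in_imset ends_inj); apply: eq_card => E.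
apply/imsetP/imsetP => -[[a b]]; rewrite inE /=; last first.
  by move=> ab ->; exists (a, b); rewrite // inE /= ab.
case/orP=> ab ->; first by exists (a, b); rewrite // inE.
by exists (b, a); rewrite ?inE // /ends setUC.
Qed.

(** * The bipartite double cover of an oriented graph *)

Definition cover_edge (G : ograph) : rel (G * bool) :=
  fun a b => [&& ~~ a.2, b.2 & oedge a.1 b.1] || [&& a.2, ~~ b.2 & oedge b.1 a.1].

Lemma cover_nonempty (G : ograph) : (0 < #|{: G * bool}|)%N.
Proof. by rewrite card_prod card_bool muln_gt0 ograph_nonempty. Qed.

Lemma cover_sym (G : ograph) : symmetric (@cover_edge G).
Proof. by move=> a b; rewrite /cover_edge orbC; do 2 case: (_.2). Qed.

Lemma cover_irr (G : ograph) : irreflexive (@cover_edge G).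
Proof. by move=> a; rewrite /cover_edge; case: a.2. Qed.

Definition cover_graph (G : ograph) : sgraph :=
  SGraph (cover_nonempty G) (@cover_sym G) (@cover_irr G).

Lemma cover_bi_edge (G : ograph) (a b : cover_graph G) :
  sedge a b -> (a \in [set c | ~~ c.2]) != (b \in [set c | ~~ c.2]).
Proof. by rewrite !inE /= /cover_edge; do 2 case: (_.2). Qed.

Definition cover (G : ograph) : bigraph := BiGraph (@cover_bi_edge G).

Lemma t_bip_cover (A : bigraph) (G : ograph) :
  t_bip A (cover G) = rel_density (@arc A) (@oedge G).
Proof.
(* Each part is a copy of [G], so both projections have fibres of size 1. *)
rewrite (@t_bip_rel_density A (cover G) G
  (fun x => (x, false)) (fun x => (x, true)) 1 1) //.
- rewrite /rel_density; congr (#|pred_of_set _|%:R / _).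
  apply/setP => f; apply/rel_homsP/rel_homsP => fP x y /fP;
  by rewrite /= /cover_edge /= orbF.
- by move=> x; rewrite inE.
- by move=> x; rewrite !inE.
- move=> [x []]; rewrite ?inE // => _.
  by rewrite -(cards1 x); apply: eq_card => y; rewrite !inE xpair_eqE andbT.
- move=> [x []]; rewrite ?inE // => _.
  by rewrite -(cards1 x); apply: eq_card => y; rewrite !inE xpair_eqE andbT.
Qed.

(** * Bipartite graphs as relations on pairs of vertices *)

Definition part_pair (H : bigraph) : finType :=
  ({x : H | x \in part1 H} * {x : H | x \in part2 H})%type.

Definition part_pair_rel (H : bigraph) : rel (part_pair H) :=
  fun a b => sedge (val a.1) (val b.2).

Lemma t_bip_part_pair (A H : bigraph) :
  part1 H != set0 -> part2 H != set0 ->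
  t_bip A H = rel_density (@arc A) (@part_pair_rel H).
Proof.
move=> H1 H2.
(* The fibre of one projection is a copy of the other part, hence the swapped sizes. *)
apply: (@t_bip_rel_density A H (part_pair H) (fun a => val a.1)
  (fun a => val a.2) #|part2 H| #|part1 H|).
- by rewrite card_gt0.
- by rewrite card_gt0.
- by move=> a; exact: valP.
- by move=> a; exact: valP.
- move=> u uH.
  transitivity #|setX [set Sub u uH : {x : H | x \in part1 H}]
                      [set: {x : H | x \in part2 H}]|.
    by apply: eq_card => a; rewrite !inE andbT -val_eqE.
  by rewrite cardsX cards1 mul1n cardsT card_sig; apply: eq_card.
- move=> u uH.
  transitivity #|setX [set: {x : H | x \in part1 H}]
                      [set Sub u uH : {x : H | x \in part2 H}]|.
    by apply: eq_card => a; rewrite !inE -val_eqE.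
  by rewrite cardsX cards1 muln1 cardsT card_sig; apply: eq_card.
Qed.

Theorem theorem1p5 (B : ograph) (h : B -> dK2) (hom_h : is_ohom h) :
  asymmetric_Sidorenko (underlying_bip hom_h) <-> directed_Sidorenko B.
Proof.
split=> [asymB G | dirB H H1 H2].
  (* The vertex [x] witnesses that both parts of the cover are non-empty. *)
  have [x _] := card_gt0P (ograph_nonempty G).
  have := asymB (cover G); rewrite !t_bip_cover card_sedges_underlying.
  rewrite (eq_rel_density _ arc_K2) (eq_rel_density _ (@arc_underlying _ _ hom_h)).
  by apply; apply/set0Pn; [exists (x, false) | exists (x, true)]; rewrite !inE.
rewrite !t_bip_part_pair // card_sedges_underlying.
rewrite (eq_rel_density _ arc_K2) (eq_rel_density _ (@arc_underlying _ _ hom_h)).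
apply: directed_Sidorenko_rel => //.
case/set0Pn: H1 => u uH; case/set0Pn: H2 => v vH.
by apply/card_gt0P; exists (Sub u uH, Sub v vH).
Qed.
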